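(* Let $\mathcal{T} \subseteq \mathcal{F}$ be a chain. There exists a map $\phi : \mathcal{T}_* \cap \mathcal{F} \rightarrow \mathcal{F}$ such that: 1. for all $A \in \mathcal{T}_* \cap \mathcal{F}$, $\phi(A) \triangle A \in \mathcal{N}$; 2. for all $A, B \in \mathcal{T}_* \cap \mathcal{F}$, $[A] = [B] \iff \phi(A) = \phi(B)$, and $[A] < [B] \iff \phi(A) \subsetneq \phi(B)$; 3. for all $\mathcal{S} \subseteq \mathcal{T}_* \cap \mathcal{F}$, (a) $\bigcup \phi(\mathcal{S}) \in \mathcal{F}$ with $\nu(\bigcup \phi(\mathcal{S})) = \sup \{ \nu(A) : A \in \phi(\mathcal{S}) \}$, and (b) $\bigcap \phi(\mathcal{S}) \in \mathcal{F}$ with $\nu(\bigcap \phi(\mathcal{S})) = \inf \{ \nu(A) : A \in \phi(\mathcal{S}) \}$; 4. for all $A \in \phi(\mathcal{T}_* \cap \mathcal{F})_*$ and $N \in \mathbb{N}$, $\nu_N(A) \leq \nu(A)$; 5. if there exists a second map $\rho : \mathcal{T}_* \cap \mathcal{F} \rightarrow \mathcal{F}$ such that $\rho(A) \triangle A \in \mathcal{N}$ for all $A \in \mathcal{T}_* \cap \mathcal{F}$, then for all $\mathcal{S} \subseteq \mathcal{T}_* \cap \mathcal{F}$, (a) if $\bigcup \rho(\mathcal{S}) \in \mathcal{F}$ with $\nu(\bigcup \rho(\mathcal{S})) = \sup \{ \nu(A) : A \in \rho(\mathcal{S}) \}$, then $\left( \bigcup \phi(\mathcal{S}) \right) \triangle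 \left( \bigcup \rho(\mathcal{S}) \right) \in \mathcal{N}$, and (b) if $\bigcap \rho(\mathcal{S}) \in \mathcal{F}$ with $\nu(\bigcap \rho(\mathcal{S})) = \inf \{ \nu(A) : A \in \rho(\mathcal{S}) \}$, then $\left( \bigcap \phi(\mathcal{S}) \right) \triangle \left( \bigcap \rho(\mathcal{S}) \right) \in \mathcal{N}$.
   Context: $\mathbb{N} = \{1,2,3,\ldots\}$. For $A \subseteq \mathbb{N}$ and $N \in \mathbb{N}$ let $\nu_N(A) := \frac{1}{N}\sum_{n=1}^N I_A(n)$, where $I_A$ is the indicator function of $A$. $\mathcal{F}$ is the collection of all $A \subseteq \mathbb{N}$ for which $\nu(A) := \lim_{N\to\infty} \nu_N(A)$ exists, and $\mathcal{N} := \{A \in \mathcal{F} : \nu(A) = 0\}$ (an ideal of $\mathcal{P}(\mathbb{N})$). A chain is a collection of subsets of $\mathbb{N}$ totally ordered by inclusion. For a chain $\mathcal{T}$, $\mathcal{T}_* := \{\bigcup \mathcal{C} : \mathcal{C} \subseteq \mathcal{T}\} \cup \{\bigcap \mathcal{C} : \mathcal{C} \subseteq \mathcal{T}\}$. For a collection $\mathcal{S}$ of sets in the domain of $\phi$, $\phi(\mathcal{S}) := \{\phi(A) : A \in \mathcal{S}\}$, similarly for $\rho$; by property 2, $\phi(\mathcal{T}_* \cap \mathcal{F})$ is a chain. $[A]$ denotes the equivalence class of $A$ in the Boolean quotient $\mathcal{P}(\mathbb{N})/\mathcal{N}$, i.e. under $A \sim B \iff A \triangle B \in \mathcal{N}$;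 the quotient is ordered by $[A] \leq [B] \iff A \setminus B \in \mathcal{N}$, and $[A] < [B]$ means $[A] \leq [B]$ and $[A] \neq [B]$. For empty subfamilies: $\bigcup \emptyset = \emptyset$, $\bigcap \emptyset = \mathbb{N}$, and suprema and infima are taken in $[0,1]$ (so $\sup\emptyset = 0$, $\inf \emptyset = 1$). *)

(* Defs.v *)
From HB Require Import structures.
From mathcomp Require Import all_boot all_order all_algebra.
From mathcomp Require Import all_classical all_reals all_analysis.

Set Implicit Arguments.
Unset Strict Implicit.
Unset Printing Implicit Defensive.

Import Order.TTheory GRing.Theory Num.Theory numFieldNormedType.Exports.

Local Open Scope classical_set_scope.
Local Open Scope ring_scope.

(* The positive integers {1, 2, 3, ...} as a type, so that the empty
   intersection of subsets of posn is all of posn. *)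
Definition posn : Type := {n : nat | (0 < n)%N}.

Definition posnS (k : nat) : posn := exist (fun n => is_true (0 < n)%N) k.+1 isT.

Section Density.
Variable R : realType.
Implicit Types A B : set posn.

(* posnS k, for k < N, ranges over 1, ..., N.  The value at N = 0 is junk. *)
Definition freq (N : nat) A : R := N%:R^-1 * \sum_(k < N) \1_A (posnS k).

Definition has_density : set (set posn) := [set A | cvgn (fun N => freq N A)].

(* Meaningful only for A in has_density. *)
Definition density A : R := limn (fun N => freq N A).

Definition null_sets : set (set posn) :=
  [set A | has_density A /\ density A = 0].

(* The equivalence class [A] in the quotient P(posn) / null_sets. *)
Definition class A : set (set posn) := [set B | null_sets (A `+` B)].

(* The order of the quotient, in terms of representatives: [A] <= [B]. *)
Definition class_le A B : Prop := null_sets (A `\` B).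

Definition class_lt A B : Prop := class_le A B /\ class A <> class B.

(* Suprema and infima taken in [0, 1]: for E included in [0, 1], adjoining
   the least (resp. greatest) element of [0, 1] only affects E = set0, for which
   the library has sup set0 = inf set0 = 0. *)
Definition sup01 (E : set R) : R := sup (0 |` E).
Definition inf01 (E : set R) : R := inf (1 |` E).

End Density.

Definition chain (T : set (set posn)) : Prop := total_on T subset.

Definition star (T : set (set posn)) : set (set posn) :=
  [set \bigcup_(A in C) A | C in [set C | C `<=` T]] `|`
  [set \bigcap_(A in C) A | C in [set C | C `<=` T]].

(* Main.v *)
Require Import Defs.
From HB Require Import structures.
From mathcomp Require Import all_boot all_order all_algebra.
From mathcomp Require Import all_classical all_reals all_analysis.
From mathcomp Require Import lra zify.
Import Order.TTheory GRing.Theory Num.Theory numFieldNormedType.Exports.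
Local Open Scope classical_set_scope.
Local Open Scope ring_scope.
Set Implicit Arguments.
Unset Strict Implicit.
Unset Printing Implicit Defensive.

(** Along the chain, classes modulo null sets are determined by their density:
    if [A `<=` B] both have densities, then [B `\` A] has density
    [density B - density A].  Hence everything reduces to finding a family of
    sets [C t], nondecreasing in the real number [t], such that [C t] represents
    the class of density [t] when there is one, and [phi A := C (density A)].

    The decisive requirement on [C] is the uniform bound [freq N (C t) <= t] for
    every [N].  It makes every upper estimate automatic: for a set [S] of
    members of the chain with supremum [s] and infimum [i] of the densities,
    the union of [phi @` S] lies inside [C s] and the intersection contains
    [C i] while having all its frequencies bounded by those of each member.  The
    union therefore has density [s] as soon as each [C (density A)] has density
    [density A], and the intersection has density [i] as soon as [C i] has lower
    density at least [i].  So [C] must behave well not only at the densities of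
    the chain but also at their infima, where the chain may have no member.

    To reach these points, for each rational [r] let [w r] be the infimum of
    the densities [>= r].  A diagonal argument ([exists_infimum_set]) provides
    a set [B r] of density [w r] almost contained in every member of density
    [>= r].  For any infimum [s] of densities, a rational [r <= s] close to [s]
    satisfies [r <= w r <= s], so countably many sets [B r] control everything
    ([exists_dominated_representatives]).

    It remains to turn a countable family [B j] of densities [q j], increasing
    in [q j] modulo null sets, into an honest chain with dominated frequencies
    ([exists_dominated_chain]).  Each [B j] is thinned on a null set to a [B' j]
    with all frequencies at most [q j] ([exists_thinning]).  The countably many
    null sets measuring the failure of [B j = B' j] and of the inclusions are
    absorbed, up to finite sets, in a single null set [Z]
    ([null_sets_pseudounion]), and [C t] is the union over [q j <= t] of
    the sets [B j] from a late threshold [k j] on, minus [Z].  Up to [N] only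
    the finitely many [j] with [k j < N] matter, and past the thresholds the one
    with the largest [q j] contains, outside [Z], all the others and lies in
    [B' j].

    For the last clause, if [rho A] and [phi A] agree modulo null sets and
    both unions have the supremum [s] as density, then each union is exhausted,
    up to upper density [e], by a single member of density [>= s - e]; dually
    for intersections. *)

(** * Counting functions and frequencies *)

Section Frequencies.
Context {R : realType}.
Implicit Types (A B C : set posn) (N : nat) (x y : R).

Definition count_upto N A : R := \sum_(k < N) \1_A (posnS k).

Lemma freqE N A : freq R N A = N%:R^-1 * count_upto N A.
Proof. by []. Qed.

Lemma count_uptoS N A :
  count_upto N.+1 A = count_upto N A + \1_A (posnS N).
Proof. by rewrite /count_upto big_ord_recr. Qed.

Lemma count_upto_ge0 N A : 0 <= count_upto N A.
Proof. by apply: sumr_ge0 => i _; rewrite indicE ler0n. Qed.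

Lemma count_uptoU N A B C :
  A `<=` B `|` C -> count_upto N A <= count_upto N B + count_upto N C.
Proof.
move=> ABC; rewrite /count_upto -big_split; apply: ler_sum => i _ /=.
rewrite !indicE -natrD ler_nat.
case: (boolP (posnS i \in A)) => // /set_mem /ABC[] /mem_set -> //=.
by rewrite addnC.
Qed.

Lemma count_upto_subset N A B : A `<=` B -> count_upto N A <= count_upto N B.
Proof.
move=> AB; have /(count_uptoU N) : A `<=` B `|` set0 by rewrite setU0.
by rewrite {3}/count_upto big1 ?addr0// => i _; rewrite indic0.
Qed.

Lemma freq_ge0 N A : 0 <= freq R N A.
Proof. by rewrite freqE mulr_ge0 ?invr_ge0 ?ler0n ?count_upto_ge0. Qed.

Lemma freq_subset N A B : A `<=` B -> freq R N A <= freq R N B.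
Proof.
by move=> AB; rewrite !freqE ler_wpM2l ?invr_ge0 ?ler0n ?count_upto_subset.
Qed.

Lemma freqU N A B C :
  A `<=` B `|` C -> freq R N A <= freq R N B + freq R N C.
Proof.
by move=> ABC; rewrite !freqE -mulrDr ler_wpM2l ?invr_ge0 ?ler0n ?count_uptoU.
Qed.

Lemma freqD N A B :
  freq R N (A `\` B) = freq R N A - freq R N B + freq R N (B `\` A).
Proof.
rewrite !freqE -mulrBr -mulrDr; congr (_ * _).
rewrite /count_upto -sumrB -big_split; apply: eq_bigr => i _ /=.
rewrite !indicE !in_setD.
by case: (_ \in A); case: (_ \in B); rewrite /=; lra.
Qed.

Lemma freq_le N A x :
  0 <= x -> count_upto N A <= x * N%:R -> freq R N A <= x.
Proof.
case: N => [x0 _|N]; first by rewrite freqE invr0 mul0r.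
by move=> _ cA; rewrite freqE mulrC ler_pdivrMr// ltr0n.
Qed.

Lemma freq_count N A : freq R N A * N%:R = count_upto N A.
Proof.
case: N => [|N]; first by rewrite mulr0 /count_upto big_ord0.
by rewrite freqE mulrC mulrA divff ?mul1r ?pnatr_eq0.
Qed.

Lemma freqT_le1 N : freq R N setT <= 1.
Proof.
apply: freq_le => //; rewrite /count_upto mul1r.
rewrite (eq_bigr (fun=> 1)) => [|i _]; last by rewrite indicT.
by rewrite sumr_const card_ord.
Qed.

Lemma freq_le1 N A : freq R N A <= 1.
Proof. exact: le_trans (freq_subset N (@subsetT _ A)) (freqT_le1 N). Qed.

End Frequencies.

(** * Upper and lower densities, inclusion modulo null sets *)

Section Densities.
Context {R : realType}.
Implicit Types (A B C : set posn) (N : nat) (x y : R).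

(** One-sided bounds on the upper and lower densities, stated without limits:
    they make sense for sets that have no density. *)
Definition udens_le A x :=
  forall e, 0 < e -> \forall N \near \oo, freq R N A <= x + e.

Definition ldens_ge A x :=
  forall e, 0 < e -> \forall N \near \oo, x - e <= freq R N A.

Definition ae_subset A B := udens_le (A `\` B) 0.

Lemma densP A x :
  (has_density R A /\ density R A = x) <-> (udens_le A x /\ ldens_ge A x).
Proof.
split=> [[cA dA]|[uA lA]].
  have {}cA : (fun N => freq R N A) @ \oo --> x.
    by move: cA; rewrite /has_density/= -dA.
  move/cvgrPdist_le : cA => cA; split=> e e0; near=> N;
  have : `|x - freq R N A| <= e by near: N; exact: cA.
    by rewrite ler_norml => /andP[]; lra.
  by rewrite ler_norml => /andP[]; lra.
have cA : (fun N => freq R N A) @ \oo --> x.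
  apply/cvgrPdist_le => e e0; near=> N; rewrite ler_norml.
  have : freq R N A <= x + e by near: N; exact: uA.
  have : x - e <= freq R N A by near: N; exact: lA.
  by move=> ? ?; apply/andP; split; lra.
by split; [apply/cvg_ex; exists x | exact/cvg_lim].
Unshelve. all: by end_near. Qed.

Lemma has_densityP A :
  has_density R A -> udens_le A (density R A) /\ ldens_ge A (density R A).
Proof. by move=> dA; apply/densP. Qed.

Lemma nullP A : null_sets R A <-> udens_le A 0.
Proof.
split=> [/densP[]//|uA]; apply/densP; split=> // e e0.
by near=> N; have := @freq_ge0 R N A; lra.
Unshelve. all: by end_near. Qed.

Lemma udens_leU A B C x y :
  A `<=` B `|` C -> udens_le B x -> udens_le C y -> udens_le A (x + y).
Proof.
move=> ABC uB uC e e0; have e2 : 0 < e / 2 by lra.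
near=> N; have := freqU (R := R) N ABC.
have : freq R N B <= x + e / 2 by near: N; exact: uB.
have : freq R N C <= y + e / 2 by near: N; exact: uC.
lra.
Unshelve. all: by end_near. Qed.

Lemma udens_leW A B x y :
  A `<=` B -> x <= y -> udens_le B x -> udens_le A y.
Proof.
move=> AB xy uB e e0; near=> N; have := freq_subset (R := R) N AB.
have : freq R N B <= x + e by near: N; exact: uB.
lra.
Unshelve. all: by end_near. Qed.

Lemma ldens_geW A B x y :
  A `<=` B -> y <= x -> ldens_ge A x -> ldens_ge B y.
Proof.
move=> AB xy lA e e0; near=> N; have := freq_subset (R := R) N AB.
have : x - e <= freq R N A by near: N; exact: lA.
lra.
Unshelve. all: by end_near. Qed.

Lemma udens_le_eps A x :
  (forall e, 0 < e -> udens_le A (x + e)) -> udens_le A x.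
Proof.
move=> uA e e0; have e2 : 0 < e / 2 by lra.
near=> N; have : freq R N A <= (x + e / 2) + e / 2 by near: N; exact: uA.
lra.
Unshelve. all: by end_near. Qed.

Lemma ldens_ge_eps A x :
  (forall e, 0 < e -> ldens_ge A (x - e)) -> ldens_ge A x.
Proof.
move=> lA e e0; have e2 : 0 < e / 2 by lra.
near=> N; have : (x - e / 2) - e / 2 <= freq R N A by near: N; exact: lA.
lra.
Unshelve. all: by end_near. Qed.

Lemma udens_le_freq A x : (forall N, freq R N A <= x) -> udens_le A x.
Proof. by move=> fA e e0; near=> N; have := fA N; lra.
Unshelve. all: by end_near. Qed.

(** This quantifies the rigidity of a chain: an almost inclusion and a small gap
    between densities force a small difference. *)
Lemma udens_leD A B x y : udens_le A x -> ldens_ge B y -> ae_subset B A ->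
  udens_le (A `\` B) (x - y).
Proof.
move=> uA lB uBA e e0; have e3 : 0 < e / 3 by lra.
near=> N; rewrite freqD.
have : freq R N A <= x + e / 3 by near: N; exact: uA.
have : y - e / 3 <= freq R N B by near: N; exact: lB.
have : freq R N (B `\` A) <= 0 + e / 3 by near: N; exact: uBA.
lra.
Unshelve. all: by end_near. Qed.

(** The frequency of [B] is at least that of [A] minus that of the null set
    [A `\` B]. *)
Lemma ldens_ge_ae A B x : ldens_ge A x -> ae_subset A B -> ldens_ge B x.
Proof.
move=> lA uAB e e0; have e2 : 0 < e / 2 by lra.
near=> N; have := @freqD R N A B; have := @freq_ge0 R N (B `\` A).
have : x - e / 2 <= freq R N A by near: N; exact: lA.
have : freq R N (A `\` B) <= 0 + e / 2 by near: N; exact: uAB.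
lra.
Unshelve. all: by end_near. Qed.

Lemma subset_ae A B : A `<=` B -> ae_subset A B.
Proof.
move=> AB; rewrite /ae_subset; have -> : A `\` B = set0 by rewrite setD_eq0.
apply: udens_le_freq => N; apply: freq_le => //.
by rewrite /count_upto big1 ?mul0r// => i _; rewrite indic0.
Qed.

Lemma ae_subset_trans B A C : ae_subset A B -> ae_subset B C -> ae_subset A C.
Proof.
move=> AB BC; rewrite /ae_subset -[0]addr0.
apply: udens_leU AB BC => p [Ap nCp].
by have [Bp|nBp] := pselect (B p); [right|left].
Qed.

Lemma symdiff_nullP A B :
  null_sets R (A `+` B) <-> ae_subset A B /\ ae_subset B A.
Proof.
rewrite nullP; split=> [uAB|[AB BA]].
  by split; apply: udens_leW (lexx 0) uAB => p [? ?]; [left|right].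
by rewrite -[0]addr0; apply: udens_leU AB BA.
Qed.

Lemma ae_subset_le A B x y :
  ae_subset A B -> ldens_ge A x -> udens_le B y -> x <= y.
Proof.
move=> AB lA uB; apply/ler_addgt0Pr => e e0; have e2 : 0 < e / 2 by lra.
have lB := ldens_ge_ae lA AB.
near \oo => N.
have : freq R N B <= y + e / 2 by near: N; exact: uB.
have : x - e / 2 <= freq R N B by near: N; exact: lB.
lra.
Unshelve. all: by end_near. Qed.

(** Bounding the values of [A] rather than assuming finiteness is the form in
    which the diagonal arguments deliver finite exceptional sets. *)
Lemma finite_null A h : (forall p, A p -> (val p < h)%N) -> udens_le A 0.
Proof.
move=> Ah e e0.
have cA N : count_upto N A <= (h%:R : R).
  elim: N => [|N]; first by rewrite /count_upto big_ord0.
  have [/mem_set ANp _|AN] := pselect (A (posnS N)); last first.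
    by rewrite count_uptoS indicE memNset// addr0.
  have Nh : (N.+1 < h)%N by exact: (Ah (posnS N) (set_mem ANp)).
  apply: (@le_trans _ _ N.+1%:R); last by rewrite ler_nat; lia.
  rewrite /count_upto; apply: (@le_trans _ _ (\sum_(k < N.+1) 1)).
    by apply: ler_sum => i _; rewrite indicE; case: (_ \in _).
  by rewrite sumr_const card_ord.
near=> N; rewrite add0r; apply: freq_le; first exact: ltW.
apply: le_trans (cA N) _; rewrite mulrC -ler_pdivrMr//.
by near: N; exact: nbhs_infty_ger.
Unshelve. all: by end_near. Qed.

Lemma null_bigcup_lt (F : nat -> set posn) n :
  (forall i, (i < n)%N -> udens_le (F i) 0) ->
  udens_le (\bigcup_(i in `I_n) F i) 0.
Proof.
elim: n => [|n IH] uF.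
  by apply: (@finite_null _ 0%N) => p [].
rewrite -[0]addr0; apply: (@udens_leU _ (\bigcup_(i in `I_n) F i) (F n)).
- move=> p [i /=]; rewrite ltnS leq_eqVlt => /orP[/eqP ->|ilt] Fp.
    by right.
  by left; exists i.
- by apply: IH => i /ltnW; exact: uF.
- exact: uF.
Qed.

End Densities.

(** Used to choose the scales of the diagonal constructions: property [j] is
    switched on at [k j], and at each stage finitely many are on. *)
Lemma exists_thresholds (P : nat -> nat -> Prop) :
  (forall j, \forall n \near \oo, P j n) ->
  exists2 k : nat -> nat, {homo k : i j / (i < j)%N} &
    forall j n, (k j <= n)%N -> P j n.
Proof.
move=> evP; have /choice[h hP] j : exists h, forall n, (h <= n)%N -> P j n.
  by have [h _ hP] := evP j; exists h => n; exact: hP.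
exists (fun j => \sum_(i < j.+1) (h i).+1)%N.
  apply: homo_ltn => [|i]; first exact: ltn_trans.
  by rewrite [ltnRHS]big_ord_recr/=; lia.
move=> j n /(leq_trans _) le; apply: hP; apply: le.
by rewrite big_ord_recr/=; lia.
Qed.

(** * Diagonal arguments *)

Section Diagonal.
Context {R : realType}.
Implicit Types (A B C : set posn) (N : nat) (x y : R).

Lemma freq_subset_upto N A B :
  (forall p, (val p <= N)%N -> A p -> B p) -> freq R N A <= freq R N B.
Proof.
move=> AB; rewrite !freqE ler_wpM2l ?invr_ge0 ?ler0n//.
apply: ler_sum => i _; rewrite !indicE ler_nat.
case: (boolP (posnS i \in A)) => // /set_mem.
by move=> /(AB (posnS i) (ltn_ord i))/mem_set ->.
Qed.

Lemma freqC N A : (0 < N)%N -> freq R N A + freq R N (~` A) = 1.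
Proof.
move=> N0; rewrite !freqE -mulrDr.
rewrite -[X in _ * X](_ : N%:R = _) ?mulVf ?pnatr_eq0 -?lt0n//.
rewrite /count_upto -big_split (eq_bigr (fun=> 1)) => [|i _] /=.
  by rewrite sumr_const card_ord.
by rewrite !indicE in_setC; case: (_ \in A); rewrite /= ?addr0 ?add0r.
Qed.

Lemma ldens_geC A x : udens_le A x -> ldens_ge (~` A) (1 - x).
Proof.
move=> uA e e0; near=> N.
have /(freqC A) : (0 < N)%N by near: N; exact: nbhs_infty_gt.
have : freq R N A <= x + e by near: N; exact: uA.
lra.
Unshelve. all: by end_near. Qed.

Lemma udens_leC A x : ldens_ge A x -> udens_le (~` A) (1 - x).
Proof.
move=> lA e e0; near=> N.
have /(freqC A) : (0 < N)%N by near: N; exact: nbhs_infty_gt.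
have : x - e <= freq R N A by near: N; exact: lA.
lra.
Unshelve. all: by end_near. Qed.

Lemma homo_ltn_geq_id (k : nat -> nat) :
  {homo k : i j / (i < j)%N} -> forall i, (i <= k i)%N.
Proof. by move=> kS; elim=> // i /leq_ltn_trans; apply; exact: kS. Qed.

(** Require membership in [A m] only from a scale [k m] on.  Up to an [N] with
    [k m <= N < k m.+1], the resulting set contains [A m], whose frequency at [N]
    is almost [x] if [k m] is large. *)
Lemma diagonal_nonincreasing (A : nat -> set posn) x :
  (forall i j, (i <= j)%N -> A j `<=` A i) -> (forall n, ldens_ge (A n) x) ->
  exists2 B, ldens_ge B x &
    exists k : nat -> nat, forall n p, (k n <= val p)%N -> B p -> A n p.
Proof.
move=> Adec lA.
have /exists_thresholds[k kS kP] n :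
    \forall N \near \oo, x - n.+1%:R^-1 <= freq R N (A n).
  by apply: lA; rewrite invr_gt0 ltr0n.
exists [set p | forall m, (k m <= val p)%N -> A m p]; last first.
  by exists k => n p kp; exact.
move=> e e0; have [m0 _ m0P] := near_infty_natSinv_lt (PosNum e0).
near=> N.
have Nm0 : (k m0 <= N)%N by near: N; exact: nbhs_infty_ge.
have ub m : (k m <= N)%N -> (m <= N)%N.
  exact: leq_trans (homo_ltn_geq_id kS m).
case: (ex_maxnP (ex_intro (fun m => (k m <= N)%N) m0 Nm0) ub) => m kmN mmax.
have : freq R N (A m) <=
    freq R N [set p | forall m, (k m <= val p)%N -> A m p].
  apply: freq_subset_upto => p pN Ap i /leq_trans/(_ pN)/mmax/Adec; exact.
have : m.+1%:R^-1 < e := m0P m (mmax _ Nm0).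
have := kP m N kmN; move: m.+1%:R^-1 => d; lra.
Unshelve. all: by end_near. Qed.

(** Null sets form a P-ideal: apply the diagonal argument to the complements of
    the finite unions, which have density 1. *)
Lemma null_sets_pseudounion (Z : nat -> set posn) :
  (forall j, udens_le (Z j) (0 : R)) ->
  exists2 Z', udens_le Z' (0 : R) &
    exists h : nat -> nat, forall j p, (h j <= val p)%N -> Z j p -> Z' p.
Proof.
move=> uZ; have [|n|B lB [h hP]] :=
  @diagonal_nonincreasing (fun n => ~` \bigcup_(i in `I_n.+1) Z i) 1.
- move=> i j ij; apply: subsetC => p [l /= li Zp]; exists l => //=.
  exact: leq_trans ij.
- rewrite -[1](subr0 1); apply: ldens_geC; exact: null_bigcup_lt.
- exists (~` B); first by rewrite -(subrr 1); exact: udens_leC.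
  exists h => j p hp Zp Bp; apply: (hP j p hp Bp).
  by exists j => /=.
Qed.

End Diagonal.

(** * Thinning a set below its density *)

Section Thinning.
Context {R : realType}.
Implicit Types (A : set posn) (q : R).

(** The number of elements deleted among the first [n] integers by the greedy
    procedure that deletes an element of [A] exactly when keeping it would push
    the count above [q * n]. *)
Fixpoint removed A q (n : nat) : R :=
  if n is m.+1 then
    if (posnS m \in A) && (q * n%:R < count_upto n A - removed A q m)
    then removed A q m + 1 else removed A q m
  else 0.

(** When a deletion occurs at [n], the number of previous deletions is less than
    the excess [count_upto n A - q * n], which is bounded by some
    [o(n)].  So the deleted elements form a null set. *)
Lemma exists_thinning A q : 0 <= q -> udens_le A q ->
  exists A', [/\ A' `<=` A, forall N, count_upto N A' <= q * N%:R
    & udens_le (A `\` A') (0 : R)].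
Proof.
move=> q0 uA.
pose D : set posn := [set p | A p /\
  q * (val p)%:R < count_upto (val p) A - removed A q (val p).-1].
have cD N : count_upto N D = removed A q N.
  elim: N => [|N IH]; first by rewrite /count_upto big_ord0.
  rewrite count_uptoS IH indicE /=; case: ifPn => [/andP[/set_mem AN lt]|nD].
    by rewrite mem_set.
  rewrite memNset ?addr0// => -[/mem_set AN lt]; move: nD.
  by rewrite AN lt.
have DA : A `\` (A `\` D) = D.
  by rewrite setDD; apply/seteqP; split=> p [] //=.
have cAD N : count_upto N A = count_upto N (A `\` D) + removed A q N.
  rewrite -cD /count_upto -big_split; apply: eq_bigr => i _ /=.
  rewrite !indicE in_setD.
  case: (boolP (posnS i \in D)) => [/set_mem[/mem_set ->]|] /=.
    by rewrite add0r.
  by rewrite addr0 andbT.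
exists (A `\` D); split; first exact: subDsetl.
  move=> N; suff : count_upto N A - removed A q N <= q * N%:R.
    by rewrite cAD addrK.
  elim: N => [|N IH]; first by rewrite /count_upto big_ord0 subr0 mulr0.
  rewrite [removed _ _ _]/=; case: ifPn => [_|].
    rewrite count_uptoS indicE.
    have : (posnS N \in A)%:R <= (1 : R) by case: (_ \in _).
    by rewrite -natr1; nra.
  rewrite negb_and => /orP[/negbTE AN|]; last by rewrite -leNgt.
  by rewrite count_uptoS indicE AN -natr1 mulr0n addr0; nra.
rewrite DA => e e0; have e2 : 0 < e / 2 by lra.
(* The additive constant [K] pays for the finitely many initial frequencies. *)
have [K _ KP] := uA _ e2.
have cA N : count_upto N A <= (q + e / 2) * N%:R + K%:R.
  have [/KP /=|NK] := leqP K N.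
    move=> /(ler_wpM2r (ler0n R N)); rewrite freq_count.
    by have := ler0n R K; lra.
  have := ler_wpM2r (ler0n R N) (@freq_le1 R N A).
  rewrite freq_count mul1r => cN.
  have : N%:R <= (K%:R : R) by rewrite ler_nat ltnW.
  have : 0 <= (q + e / 2) * N%:R by rewrite mulr_ge0 ?ler0n// addr_ge0// ltW.
  lra.
have rA N : removed A q N <= e / 2 * N%:R + K%:R + 1.
  elim: N => [|N IH]; first by rewrite /= mulr0 add0r addr_ge0 ?ler0n.
  rewrite [removed _ _ _]/=; case: ifPn => [/andP[_]|_].
    by have := cA N.+1; lra.
  by rewrite -(natr1 N); lra.
near=> N; rewrite add0r; apply: freq_le; first exact: ltW.
rewrite cD; apply: le_trans (rA N) _.
have : (K%:R + 1) / (e / 2) <= (N%:R : R).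
  by near: N; exact: nbhs_infty_ger.
by rewrite ler_pdivrMr//; lra.
Unshelve. all: by end_near. Qed.

End Thinning.

(** * A chain of sets with dominated frequencies *)

Lemma near_forall_lt (P : nat -> nat -> Prop) n :
  (forall i, \forall N \near \oo, P i N) ->
  \forall N \near \oo, forall i, (i < n)%N -> P i N.
Proof.
move=> evP; have /exists_thresholds[k kS kP] := evP.
near=> N; move=> i ilt; apply: kP; apply: (@leq_trans (k n)).
  by apply: ltnW; exact: kS.
by near: N; exact: nbhs_infty_ge.
Unshelve. all: by end_near. Qed.

Section Interleaving.
Context {R : realType}.

(** The frequency bound is proved by following, as [N] grows, the index [J] of
    largest [q J] among those with [q j <= t] and [k j < N], and comparing the
    count of [C t] with that of [B' J].  While [J] does not change, new elements
    of [C t] lie in [B' J].  When a better [J] takes over from [i], the invariant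
    survives because [k J] was chosen so late that the count of [B' J] is
    already at least [q i * n], which bounds the count of [B' i]. *)
Lemma exists_dominated_chain (B : nat -> set posn) (q : nat -> R) :
  (forall j, 0 <= q j) ->
  (forall j, udens_le (B j) (q j)) -> (forall j, ldens_ge (B j) (q j)) ->
  (forall i j, q i <= q j -> ae_subset (R := R) (B i) (B j)) ->
  exists C : R -> set posn,
    [/\ forall s t, s <= t -> C s `<=` C t,
        forall t N, 0 <= t -> freq R N (C t) <= t
      & forall j t, q j <= t -> ae_subset (R := R) (B j) (C t)].
Proof.
move=> q0 uB lB Bmono.
have /choice[B' B'P] := fun j => exists_thinning (q0 j) (uB j).
have cB' j N : count_upto N (B' j) <= q j * N%:R.
  by have [] := B'P j.
have nB' j : ae_subset (R := R) (B j) (B' j) by have [] := B'P j.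
(* The elements to avoid so that, for both orders of [q i] and [q j], the
   inclusion between [B i] and [B j] holds and [B j] lies in [B' j].  Only
   [i <= j] is needed below, so that finitely many of them concern each [j]. *)
pose W j i : set posn := (B j `\` B' j) `|`
  ([set p | q i <= q j /\ (B i `\` B j) p] `|`
   [set p | q j <= q i /\ (B j `\` B i) p]).
have nB i j : udens_le [set p | q i <= q j /\ (B i `\` B j) p] (0 : R).
  have [le|nle] := pselect (q i <= q j).
    by apply: (udens_leW _ (lexx 0) (Bmono _ _ le)) => p [].
  by apply: (@finite_null _ _ 0%N) => p [/nle[]].
have nW j i : udens_le (W j i) (0 : R).
  have nn : udens_le ([set p | q i <= q j /\ (B i `\` B j) p] `|`
     [set p | q j <= q i /\ (B j `\` B i) p]) (0 : R).
    by rewrite -[0]addr0; exact: udens_leU (@subset_refl _ _) (nB _ _) (nB _ _).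
  by rewrite -[0]addr0; exact: udens_leU (@subset_refl _ _) (nB' j) nn.
have /null_sets_pseudounion[Z nZ [h hP]] j :
    udens_le (\bigcup_(i in `I_j.+1) W j i) (0 : R).
  exact: null_bigcup_lt.
(* From [k J] on, [Z] absorbs the defects of [J], and the count of [B' J] has
   overtaken every smaller slope of an earlier index. *)
have /exists_thresholds[k kS kP] J : \forall n \near \oo, (h J <= n)%N /\
    forall i, (i < J)%N -> q i < q J -> q i * n%:R <= count_upto n (B' J).
  apply: filterI; first exact: nbhs_infty_ge.
  apply: near_forall_lt => i.
  have [lt|nlt] := pselect (q i < q J); last by near=> N.
  have lB' := ldens_ge_ae (lB J) (nB' J).
  have d0 : 0 < q J - q i by lra.
  near=> n; move=> _; rewrite -freq_count ler_wpM2r//.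
  have : q J - (q J - q i) <= freq R n (B' J) by near: n; exact: lB'.
  lra.
have kle := ltnW_homo kS.
have kI i j : k i = k j -> i = j.
  by move=> e; have [/kS|/kS|//] := ltngtP i j; rewrite e ltnn.
pose C t : set posn :=
  [set p | (exists j, [/\ q j <= t, (k j < val p)%N & B j p]) /\ ~ Z p].
have CB' t N J : q J <= t -> (k J <= N)%N ->
    (forall j, q j <= t -> (k j <= N)%N -> q j <= q J) ->
    C t (posnS N) -> B' J (posnS N).
  move=> qJ kJ Jmax [[j [qj /= kj Bj]] nZN].
  have qjJ := Jmax j qj kj.
  have hJ : (h J <= N.+1)%N.
    by apply: leqW; apply: (leq_trans (kP J _ (leqnn _)).1).
  have hj : (h j <= N.+1)%N.
    by apply: leqW; apply: (leq_trans (kP j _ (leqnn _)).1).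
  have BJ : B J (posnS N).
    apply: contrapT => nBJ; apply: nZN.
    have [le|lt] := leqP j J.
      by apply: (hP J (posnS N) hJ); exists j => //; right; left.
    by apply: (hP j (posnS N) hj); exists J => /=; [exact: ltnW|right; right].
  apply: contrapT => nB'J; apply: nZN.
  by apply: (hP J (posnS N) hJ); exists J => //=; left.
have main t N :
  (count_upto N (C t) = 0 :> R /\ forall j, q j <= t -> (N <= k j)%N) \/
  (exists J, [/\ q J <= t, (k J < N)%N,
     forall j, q j <= t -> (k j < N)%N -> q j <= q J
     & count_upto N (C t) <= count_upto N (B' J) :> R]).
  elim: N => [|N IH].
    by left; split=> //; rewrite /count_upto big_ord0.
  have step J : q J <= t -> (k J <= N)%N ->
      (forall j, q j <= t -> (k j <= N)%N -> q j <= q J) ->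
      count_upto N (C t) <= count_upto N (B' J) :> R ->
      count_upto N.+1 (C t) <= count_upto N.+1 (B' J) :> R.
    move=> qJ kJ Jmax cN; rewrite !count_uptoS lerD// !indicE ler_nat.
    case: (boolP (posnS N \in C t)) => // /set_mem.
    by move=> /(CB' _ _ _ qJ kJ Jmax)/mem_set ->.
  (* Either an index activated at [N] beats all the previous ones, or the
     previous best index remains the best. *)
  have [[j [kj qj jtop]]|notop] := pselect (exists j, [/\ k j = N, q j <= t &
      forall i, q i <= t -> (k i < N)%N -> q i < q j]).
    have jmax i : q i <= t -> (k i <= N)%N -> q i <= q j.
      move=> qi; rewrite leq_eqVlt => /orP[/eqP|ki]; last exact/ltW/jtop.
      by rewrite -kj => /kI ->.
    right; exists j; split=> //; first by rewrite kj.
    apply: step => //; first by rewrite kj.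
    case: IH => [[-> _]|[J [qJ kJ _ cN]]]; first exact: count_upto_ge0.
    apply: le_trans cN (le_trans (cB' _ _) _).
    have [_] := kP j N (eq_leq kj); apply; last exact: jtop.
    by rewrite ltnNge; apply: contraL kJ => /kle; rewrite -leqNgt kj.
  case: IH => [[cN none]|[J [qJ kJ Jmax cN]]].
    have none' j : q j <= t -> (N < k j)%N.
      move=> qj; rewrite ltn_neqAle none// andbT; apply/eqP => kj.
      apply: notop; exists j; split=> // i qi; rewrite ltnNge.
      by rewrite none.
    left; split=> //; rewrite count_uptoS cN add0r indicE memNset//.
    by move=> [[j [/none' lt]]] /=; rewrite ltnS leqNgt lt.
  have Jmax' j : q j <= t -> (k j <= N)%N -> q j <= q J.
    move=> qj; rewrite leq_eqVlt => /orP[/eqP kj|]; last exact: Jmax.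
    rewrite leNgt; apply/negP => lt; apply: notop; exists j; split=> // i qi ki.
    exact: le_lt_trans (Jmax i qi ki) lt.
  right; exists J; split=> //; first exact: ltnW.
  by apply: step => //; exact: ltnW.
exists C; split.
- move=> s t st p [[j [qj kj Bj]] nZp]; split=> //; exists j; split=> //.
  exact: le_trans st.
- move=> t N t0; apply: freq_le => //.
  case: (main t N) => [[-> _]|[J [qJ _ _ cN]]]; first by rewrite mulr_ge0.
  apply: le_trans cN (le_trans (cB' _ _) _).
  by rewrite ler_wpM2r.
- move=> j t qj; rewrite /ae_subset -[0]addr0.
  apply: (@udens_leU _ _ [set p | val p <= k j]%N Z) => //.
    move=> p [Bj nC]; have [le|lt] := leqP (val p) (k j); first by left.
    by right; apply: contrapT => nZp; apply: nC; split=> //; exists j.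
  by apply: (@finite_null _ _ (k j).+1) => p.
Unshelve. all: by end_near. Qed.

End Interleaving.

(** * Unions and intersections of subfamilies of a chain *)

Lemma comparable_star (T : set (set posn)) (U : set posn) :
  (forall A, T A -> U `<=` A \/ A `<=` U) ->
  forall V, star T V -> U `<=` V \/ V `<=` U.
Proof.
move=> TU _ [[C /= CT <-]|[C /= CT <-]].
- have [[A CA UA]|nUA] := pselect (exists2 A, C A & U `<=` A).
    by left=> p Up; exists A => //; exact: UA.
  right=> p [A CA Ap]; have [UA|] := TU A (CT _ CA); last exact.
  by case: nUA; exists A.
- have [[A CA UA]|nAU] := pselect (exists2 A, C A & A `<=` U).
    by right=> p Cp; apply: UA; exact: Cp.
  left=> p Up A CA; have [|AU] := TU A (CT _ CA); first exact.
  by case: nAU; exists A.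
Qed.

Lemma chain_star T : chain T -> chain (star T).
Proof.
move=> chT U V sU sV; apply: comparable_star sV => A TA.
have [] := @comparable_star T A _ U sU; [|by right|by left].
by move=> B TB; exact: chT.
Qed.

(** * Approximation of unions and intersections by their members *)

Section DensityFacts.
Context {R : realType}.
Implicit Types (A B P Q : set posn) (e s : R).

Lemma density_ge0 A : has_density R A -> 0 <= density R A.
Proof.
move=> /has_densityP[uA _]; apply/ler_addgt0Pr => e e0.
near \oo => N; apply: le_trans (freq_ge0 N A) _.
by near: N; exact: uA.
Unshelve. all: by end_near. Qed.

Lemma density_le1 A : has_density R A -> density R A <= 1.
Proof.
move=> /has_densityP[_ lA]; apply/ler_addgt0Pr => e e0.
rewrite -lerBlDr; near \oo => N; apply: le_trans (freq_le1 N A).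
by near: N; exact: lA.
Unshelve. all: by end_near. Qed.

Lemma density_setT : has_density R setT /\ density R setT = 1.
Proof.
apply/densP; split; first exact/udens_le_freq/freqT_le1.
rewrite -setC0 -[1](subr0 1); apply: ldens_geC.
by apply: (@finite_null _ _ 0%N) => p.
Qed.

Lemma has_sup_densities (S : set (set posn)) : S `<=` has_density R ->
  has_sup (0 |` [set density R A | A in S]).
Proof.
move=> Sd; split; first by exists 0; left.
exists 1 => _ [->|[A SA <-]]; first exact: ler01.
exact/density_le1/Sd.
Qed.

Lemma has_inf_densities (S : set (set posn)) : S `<=` has_density R ->
  has_inf (1 |` [set density R A | A in S]).
Proof.
move=> Sd; split; first by exists 1; left.
exists 0 => _ [->|[A SA <-]]; first exact: ler01.
exact/density_ge0/Sd.
Qed.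

(** A member [F A] of density close to the supremum exhausts the union up to a
    set of small upper density, and [F A] is almost contained in [G A].  If the
    supremum is the adjoined value 0, the union itself is small. *)
Lemma ae_subset_bigcup S (F G : set posn -> set posn) :
  (forall A, S A -> has_density R (F A)) ->
  (forall A, S A -> ae_subset (R := R) (F A) (G A)) ->
  udens_le (\bigcup_(A in F @` S) A) (sup01 [set density R A | A in F @` S]) ->
  ae_subset (R := R) (\bigcup_(A in F @` S) A) (\bigcup_(A in G @` S) A).
Proof.
move=> Fd FG; set P := \bigcup_(A in F @` S) A; set Q := \bigcup_(A in _) A.
set s := sup01 _ => uP; apply: udens_le_eps => e e0; rewrite add0r.
have Sd : F @` S `<=` has_density R by move=> _ [A SA <-]; exact: Fd.
have [_ [->|[_ [A SA <-] <-]]] := sup_adherent e0 (has_sup_densities Sd).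
  rewrite -/(sup01 _) -/s => lt; apply: udens_leW uP; last by lra.
  exact: subDsetl.
rewrite -/(sup01 _) -/s => lt; have [_ lF] := has_densityP (Fd A SA).
have FP : F A `<=` P by move=> p Fp; exists (F A) => //; exists A.
have PF := udens_leD uP lF (subset_ae FP).
apply: udens_leW (udens_leU (_ : P `\` Q `<=` _) PF (FG A SA)) => //; first lra.
move=> p [Pp nQp]; have [Fp|] := pselect (F A p); last by left.
by right; split=> // Gp; apply: nQp; exists (G A) => //; exists A.
Qed.

(** Dual to the case of unions: here [G A] exceeds the intersection by little. *)
Lemma ae_subset_bigcap S (F G : set posn -> set posn) :
  (forall A, S A -> has_density R (G A)) ->
  (forall A, S A -> ae_subset (R := R) (F A) (G A)) ->
  ldens_ge (\bigcap_(A in G @` S) A) (inf01 [set density R A | A in G @` S]) ->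
  ae_subset (R := R) (\bigcap_(A in F @` S) A) (\bigcap_(A in G @` S) A).
Proof.
move=> Gd FG; set Q := \bigcap_(A in G @` S) A; set P := \bigcap_(A in _) A.
set s := inf01 _ => lQ; apply: udens_le_eps => e e0; rewrite add0r.
have Sd : G @` S `<=` has_density R by move=> _ [A SA <-]; exact: Gd.
have [_ [->|[_ [A SA <-] <-]]] := inf_adherent e0 (has_inf_densities Sd).
  rewrite -/(inf01 _) -/s => lt; apply: udens_leW (udens_leC lQ); last by lra.
  by move=> p [].
rewrite -/(inf01 _) -/s => lt; have [uG _] := has_densityP (Gd A SA).
have QG : Q `<=` G A by move=> p; apply; exists A.
have GQ := udens_leD uG lQ (subset_ae QG).
apply: udens_leW (udens_leU (_ : P `\` Q `<=` _) (FG A SA) GQ) => //; first lra.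
move=> p [Pp nQp]; have [Gp|nGp] := pselect (G A p); first by right.
by left; split=> //; apply: Pp; exists A.
Qed.

End DensityFacts.

(** * Dominated representatives of a chain *)

Section Representatives.
Context {R : realType}.
Implicit Types (A B : set posn) (e r s t : R).

Variable X : set (set posn).
Hypotheses (Xchain : chain X) (Xdens : X `<=` has_density R) (XT : X setT).

Lemma chain_ae_subset A B : X A -> X B -> density R A <= density R B ->
  ae_subset (R := R) A B.
Proof.
move=> XA XB le; have [/subset_ae//|BA] := Xchain XA XB.
have [uA _] := has_densityP (Xdens XA); have [_ lB] := has_densityP (Xdens XB).
apply: udens_leW (udens_leD uA lB (subset_ae BA)) => //; lra.
Qed.

Definition densities_ge r :=
  [set density R A | A in X `&` [set A | r <= density R A]].

Lemma has_inf_densities_ge r : r <= 1 -> has_inf (densities_ge r).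
Proof.
move=> r1; split; last by exists r => _ [A [_ rA] <-].
exists 1; exists setT; last exact: density_setT.2.
by split=> //=; rewrite density_setT.2.
Qed.

(** Diagonalize a decreasing sequence of members whose densities tend to the
    infimum. *)
Lemma exists_infimum_set r : r <= 1 ->
  exists B, [/\ udens_le B (inf (densities_ge r)),
    ldens_ge B (inf (densities_ge r)) &
    forall A, X A -> r <= density R A -> ae_subset (R := R) B A].
Proof.
move=> r1; set w := inf _; have hw := has_inf_densities_ge r1.
have wle A : X A -> r <= density R A -> w <= density R A.
  by move=> XA rA; apply: ge_inf; [exact: hw.2|exists A].
have /choice[A AP] n : exists A, [/\ X A, r <= density R A &
    density R A < w + n.+1%:R^-1].
  have n0 : 0 < n.+1%:R^-1 :> R by rewrite invr_gt0 ltr0n.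
  by have [_ [A [XA rA] <-] ?] := inf_adherent n0 hw; exists A.
(* As [X] is a chain, each finite intersection is one of the sets [A i], hence a
   member. *)
pose M n := \bigcap_(i in `I_n.+1) A i.
have MA n i : (i <= n)%N -> M n `<=` A i by move=> le p; apply.
have MX n : X (M n) /\ r <= density R (M n).
  elim: n => [|n [XM rM]].
    have -> : M 0%N = A 0%N.
      by apply/seteqP; split=> [|p A0 [|i]//]; exact: MA.
    by have [] := AP 0%N.
  have ME : M n.+1 = M n `&` A n.+1.
    apply/seteqP; split=> [p Mp|p [Mp Ap] i /=].
      by split; [move=> i /= le; apply: Mp; exact: leqW|apply: Mp => /=].
    by rewrite ltnS leq_eqVlt => /orP[/eqP ->//|]; exact: Mp.
  have [XA rA _] := AP n.+1; rewrite ME.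
  by have [/setIidl ->|/setIidr ->] := Xchain XM XA.
have [||B lB [k kP]] := @diagonal_nonincreasing R M w.
- by move=> i j ij p Mp l /= li; apply: Mp => /=; exact: leq_trans ij.
- move=> n; have [XM rM] := MX n.
  have [_ lM] := has_densityP (Xdens XM).
  by apply: ldens_geW lM => //; exact: wle.
have BM n : ae_subset (R := R) B (M n).
  apply: (@finite_null _ _ (k n)) => p [Bp nMp].
  by rewrite ltnNge; apply/negP => le; apply: nMp; exact: kP le Bp.
have uM e : 0 < e -> exists n, udens_le (M n) (w + e).
  move=> e0.
  have [n _ /(_ n (leqnn n)) ne] := near_infty_natSinv_lt (PosNum e0).
  have {}ne : n.+1%:R^-1 < e := ne.
  exists n; have [XA _ Aw] := AP n.
  have [uA _] := has_densityP (Xdens XA).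
  apply: (udens_leW _ _ uA); first exact: MA.
  by move: ne Aw; move: n.+1%:R^-1 => d; lra.
exists B; split=> //.
- apply: udens_le_eps => e /uM[n un]; rewrite -[w + e]add0r.
  apply: udens_leU (BM n) un => p Bp.
  by have [|] := pselect (M n p); [right|left].
- move=> D XD rD; apply: udens_le_eps => e e0; have [n un] := uM e e0.
  rewrite -[e]addr0.
  have [XM rM] := MX n.
  have MDe : udens_le (M n `\` D) (e + 0).
    rewrite addr0; have [MD|DM] := Xchain XM XD.
      by apply: udens_leW (subset_ae MD) => //; exact: ltW.
    have [_ lD] := has_densityP (Xdens XD).
    apply: udens_leW (udens_leD un lD (subset_ae DM)) => //.
    by have := wle D XD rD; lra.
  apply: udens_leU (BM n) MDe => p [Bp nDp].
  by have [|] := pselect (M n p); [right|left].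
Qed.

(** The lower bound at [inf E] is what intersections require: [inf E] need not be
    the density of a member of [X]. *)
Lemma exists_dominated_representatives :
  exists C : R -> set posn,
    [/\ forall s t, s <= t -> C s `<=` C t,
        forall t N, 0 <= t -> freq R N (C t) <= t,
        forall A, X A -> null_sets R (C (density R A) `+` A)
      & forall E, E !=set0 -> E `<=` [set density R A | A in X] ->
          ldens_ge (C (inf E)) (inf E)].
Proof.
(* An enumeration of the rationals, truncated at 1, where [setT] ensures that
   there is a density [>= r n]. *)
pose r n : R := Num.min 1 (ratr (odflt 0 (unpickle n))).
have r1 n : r n <= 1 by rewrite /r ge_min lexx.
have /choice[B BP] := fun n => exists_infimum_set (r1 n).
pose q n := inf (densities_ge (r n)).
have uB n : udens_le (B n) (q n) by have [] := BP n.
have lB n : ldens_ge (B n) (q n) by have [] := BP n.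
have BX n A : X A -> r n <= density R A -> ae_subset (R := R) (B n) A.
  by have [_ _] := BP n; apply.
have hq n := has_inf_densities_ge (r1 n).
have q0 n : 0 <= q n.
  by apply: lb_le_inf (hq n).1 _ => _ [A [XA _] <-]; exact/density_ge0/Xdens.
have rq n : r n <= q n by apply: lb_le_inf (hq n).1 _ => _ [A [_ rA] <-].
(* For a member [A] with density just above [q j], [B i] is almost contained in
   [A], which exceeds [B j] by little. *)
have qB i j : q i <= q j -> ae_subset (R := R) (B i) (B j).
  move=> qij; apply: udens_le_eps => e e0.
  have [_ [A [XA rA] <-] Ae] := inf_adherent e0 (hq j).
  have qA : q j <= density R A by apply: ge_inf; [exact: (hq j).2|exists A].
  have rjA : r i <= density R A by have := rq i; lra.
  have [uA _] := has_densityP (Xdens XA).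
  apply: (@udens_leU _ _ (B i `\` A) (A `\` B j)).
  - move=> p [Bi nBj]; have [|] := pselect (A p); [right|left]; by [].
  - exact: BX.
  - apply: udens_leW (udens_leD uA (lB j) (BX j A XA rA)) => //.
    by rewrite /q; lra.
have [C [Cmono Cfreq CB]] := exists_dominated_chain q0 uB lB qB.
have approx s e : s <= 1 -> 0 < e -> exists n, s - e < r n <= s.
  move=> s1 e0; have /rat_in_itvoo[x] : s - e < s by lra.
  rewrite in_itv/= => /andP[ex xs]; exists (pickle x).
  have x1 : ratr x <= (1 : R) by apply: ltW; apply: lt_le_trans s1.
  by rewrite /r pickleK/= min_r// ex ltW.
have lC E : E !=set0 -> E `<=` [set density R A | A in X] ->
    ldens_ge (C (inf E)) (inf E).
  move=> E0 EX; apply: ldens_ge_eps => e e0.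
  have lbE : has_lbound E.
    by exists 0 => _ /EX[A XA <-]; exact/density_ge0/Xdens.
  have E1 : inf E <= 1.
    have [x Ex] := E0; apply: le_trans (ge_inf lbE Ex) _.
    by have [A XA <-] := EX _ Ex; exact/density_le1/Xdens.
  have [n /andP[en ns]] := approx _ e E1 e0.
  have qn : q n <= inf E.
    apply: lb_le_inf => // x Ex; have [A XA Ax] := EX _ Ex.
    apply: ge_inf; first exact: (hq n).2.
    exists A => //; split=> //=; rewrite Ax.
    exact: le_trans ns (ge_inf lbE Ex).
  apply: ldens_geW (ldens_ge_ae (lB n) (CB n _ qn)) => //.
  by have := rq n; lra.
exists C; split=> // A XA; set t := density R A.
have [uA lA] := has_densityP (Xdens XA); rewrite -/t in uA lA.
have t0 : 0 <= t := density_ge0 (Xdens XA).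
have AC : ae_subset (R := R) A (C t).
  apply: udens_le_eps => e e0.
  have [n /andP[en nt]] := approx t e (density_le1 (Xdens XA)) e0.
  have qt : q n <= t by apply: ge_inf; [exact: (hq n).2|exists A].
  rewrite add0r -[e]addr0.
  apply: (@udens_leU _ _ (A `\` B n) (B n `\` C t)).
  - move=> p [Ap nCp]; have [|] := pselect (B n p); [right|left]; by [].
  - apply: udens_leW (udens_leD uA (lB n) (BX n A XA nt)) => //.
    by have := rq n; lra.
  - exact: CB.
apply/symdiff_nullP; split=> //; rewrite /ae_subset -(subrr t).
by apply: udens_leD lA AC; apply: udens_le_freq => N; exact: Cfreq.
Qed.

End Representatives.

Theorem theorem5p3 (R : realType) (T : set (set posn))
    (TF : T `<=` has_density R) (Tchain : chain T) :
  exists phi : {fun (star T `&` has_density R) >-> has_density R},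
  [/\ (* 1 *)
      forall A, (star T `&` has_density R) A -> null_sets R (phi A `+` A),
      (* 2 *)
      forall A B, (star T `&` has_density R) A ->
        (star T `&` has_density R) B ->
        (class R A = class R B <-> phi A = phi B) /\
        (class_lt R A B <-> phi A `<` phi B),
      (* 3 *)
      forall S, S `<=` star T `&` has_density R ->
        (has_density R (\bigcup_(A in phi @` S) A) /\
         density R (\bigcup_(A in phi @` S) A) =
           sup01 [set density R A | A in phi @` S]) /\
        (has_density R (\bigcap_(A in phi @` S) A) /\
         density R (\bigcap_(A in phi @` S) A) =
           inf01 [set density R A | A in phi @` S]),
      (* 4 *)
      forall A, star (phi @` (star T `&` has_density R)) A ->
        forall N : nat, (0 < N)%N -> freq R N A <= density R A
    & (* 5 *)
      forall rho : {fun (star T `&` has_density R) >-> has_density R},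
        (forall A, (star T `&` has_density R) A ->
          null_sets R (rho A `+` A)) ->
        forall S, S `<=` star T `&` has_density R ->
        (has_density R (\bigcup_(A in rho @` S) A) /\
         density R (\bigcup_(A in rho @` S) A) =
           sup01 [set density R A | A in rho @` S] ->
         null_sets R ((\bigcup_(A in phi @` S) A) `+`
                      (\bigcup_(A in rho @` S) A))) /\
        (has_density R (\bigcap_(A in rho @` S) A) /\
         density R (\bigcap_(A in rho @` S) A) =
           inf01 [set density R A | A in rho @` S] ->
         null_sets R ((\bigcap_(A in phi @` S) A) `+`
                      (\bigcap_(A in rho @` S) A)))].
Proof.
set X := star T `&` has_density R.
have Xdens : X `<=` has_density R by move=> A [].
have Xchain : chain X.
  by move=> A B [sA _] [sB _]; exact: (chain_star Tchain sA sB).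
have XT : X setT.
  split; first by right; exists set0; [exact: sub0set|exact: bigcap_set0].
  exact: density_setT.1.
have [C [Cmono Cfreq CX lC]] :=
  exists_dominated_representatives Xchain Xdens XT.
have Cdens A : X A ->
    has_density R (C (density R A)) /\
    density R (C (density R A)) = density R A.
  move=> XA; apply/densP; split.
    by apply: udens_le_freq => N; apply: Cfreq; exact/density_ge0/Xdens.
  have [uA lA] := has_densityP (Xdens A XA).
  by apply: ldens_ge_ae lA _; have /symdiff_nullP[] := CX A XA.
pose phi := mkfun_fun
  (fun A XA => (Cdens A XA).1 : has_density R (C (density R A))).
have phiE A : phi A = C (density R A) by [].
have dphi A : X A -> density R (phi A) = density R A by move=> /Cdens[].
have Sdens S : S `<=` X ->
    [set density R A | A in phi @` S] = [set density R A | A in S].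
  move=> SX; apply/seteqP; split=> [_ [_ [A SA <-] <-]|_ [A SA <-]].
    by exists A => //; rewrite dphi//; exact: SX.
  by exists (phi A); [exists A|rewrite dphi//; exact: SX].
have cup S : S `<=` X ->
    [/\ has_density R (\bigcup_(A in phi @` S) A),
        density R (\bigcup_(A in phi @` S) A) =
          sup01 [set density R A | A in phi @` S]
      & forall N, freq R N (\bigcup_(A in phi @` S) A) <=
          density R (\bigcup_(A in phi @` S) A)].
  move=> SX; rewrite Sdens//; set U := \bigcup_(A in _) A.
  set E := [set density R A | A in S].
  have ub1 : has_sup (0 |` E) := has_sup_densities (subset_trans SX Xdens).
  have s0 : 0 <= sup01 E by apply: ub_le_sup ub1.2 _ _; left.
  have UC : U `<=` C (sup01 E).
    move=> p [_ [A SA <-]]; apply: Cmono.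
    by apply: ub_le_sup ub1.2 _ _; right; exists A.
  have fU N : freq R N U <= sup01 E.
    exact: le_trans (freq_subset N UC) (Cfreq _ N s0).
  have [] : has_density R U /\ density R U = sup01 E.
    apply/densP; split; first exact: udens_le_freq.
    apply: ldens_ge_eps => e e0.
    have [_ [->|[A SA <-]] lt] := sup_adherent e0 ub1.
      move=> e' e'0; near=> N; have := @freq_ge0 R N U.
      by rewrite /sup01; lra.
    have [hA dA] := Cdens A (SX A SA).
    have [_ lA] := has_densityP hA.
    apply: ldens_geW lA; first by move=> p Cp; exists (phi A) => //; exists A.
    by rewrite dA; exact: ltW.
  by move=> hU dU; split=> // N; rewrite dU.
have cap S : S `<=` X ->
    [/\ has_density R (\bigcap_(A in phi @` S) A),
        density R (\bigcap_(A in phi @` S) A) =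
          inf01 [set density R A | A in phi @` S]
      & forall N, freq R N (\bigcap_(A in phi @` S) A) <=
          density R (\bigcap_(A in phi @` S) A)].
  move=> SX; rewrite Sdens//; set D := \bigcap_(A in _) A.
  set E := [set density R A | A in S].
  have [E1 lbE] : has_inf (1 |` E) := has_inf_densities (subset_trans SX Xdens).
  have EX : 1 |` E `<=` [set density R A | A in X].
    move=> _ [->|[A SA <-]]; first by exists setT => //; exact: density_setT.2.
    by exists A => //; exact: SX.
  have CD : C (inf01 E) `<=` D.
    move=> p Cp _ [A SA <-]; apply: Cmono Cp.
    by apply: ge_inf lbE _ _; right; exists A.
  have fD N : freq R N D <= inf01 E.
    apply: lb_le_inf E1 _ => _ [->|[A SA <-]]; first exact: freq_le1.
    have DA : D `<=` C (density R A) by move=> p; apply; exists A.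
    apply: le_trans (freq_subset N DA) (Cfreq _ N _).
    exact/density_ge0/Xdens/SX.
  have [] : has_density R D /\ density R D = inf01 E.
    apply/densP; split; first exact: udens_le_freq.
    exact: ldens_geW CD (lexx _) (lC _ E1 EX).
  by move=> hD dD; split=> // N; rewrite dD.
have le_dens A B : has_density R A -> has_density R B ->
    ae_subset (R := R) A B -> density R A <= density R B.
  move=> /has_densityP[_ lA] /has_densityP[uB _] AB.
  exact: ae_subset_le AB lA uB.
have symdens A B : has_density R A -> has_density R B ->
    null_sets R (A `+` B) -> density R A = density R B.
  move=> hA hB /symdiff_nullP[AB BA]; apply/eqP.
  by rewrite eq_le !le_dens.
have Xae := chain_ae_subset Xchain Xdens.
have classE A B : X A -> X B ->
    (class R A = class R B <-> density R A = density R B).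
  move=> XA XB; split=> [cAB|dAB].
    apply: symdens; [exact: Xdens|exact: Xdens|].
    have : class R B B by apply/symdiff_nullP; split; exact: subset_ae.
    by rewrite -cAB.
  have AB : ae_subset (R := R) A B by apply: Xae; rewrite ?dAB.
  have BA : ae_subset (R := R) B A by apply: Xae; rewrite ?dAB.
  apply/seteqP; split=> D /symdiff_nullP[AD DA]; apply/symdiff_nullP.
    by split; [exact: ae_subset_trans BA AD|exact: ae_subset_trans DA AB].
  by split; [exact: ae_subset_trans AB AD|exact: ae_subset_trans DA BA].
exists phi; split.
- exact: CX.
- move=> A B XA XB; have phi_eq : phi A = phi B <-> density R A = density R B.
    split=> [e|e]; last by rewrite !phiE e.
    by rewrite -(dphi A XA) -(dphi B XB) e.
  split; first by rewrite (classE A B XA XB) phi_eq.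
  have -> : class_lt R A B <-> density R A < density R B.
    rewrite /class_lt (classE A B XA XB) lt_neqAle; split.
      move=> [/nullP AB /eqP ->]; apply: le_dens => //; exact: Xdens.
    move=> /andP[/eqP ne le]; split=> //.
    by apply/nullP; exact: Xae.
  rewrite lt_neqAle; split=> [/andP[/eqP ne le]|[AB nBA]].
    split; first exact: Cmono.
    move=> BA; apply: ne; apply/phi_eq; apply/seteqP; split=> //.
    exact: Cmono.
  apply/andP; split; first by apply/eqP => /phi_eq e; apply: nBA; rewrite e.
  rewrite -(dphi A XA) -(dphi B XB); apply: le_dens (subset_ae AB).
    exact: (Cdens A XA).1.
  exact: (Cdens B XB).1.
- by move=> S SX; have [? ? _] := cup S SX; have [? ? _] := cap S SX.
- move=> _ [[S' /= S'X <-]|[S' /= S'X <-]] N _.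
  + have -> : S' = phi @` (X `&` phi @^-1` S').
      apply/seteqP; split=> [B SB|_ [A [_ SA] <-]//].
      have [A XA AB] := S'X B SB; exists A => //; split=> //=.
      by rewrite /preimage/= AB.
    by have [_ _] := cup (X `&` phi @^-1` S') (@subIsetl _ _ _); apply.
  + have -> : S' = phi @` (X `&` phi @^-1` S').
      apply/seteqP; split=> [B SB|_ [A [_ SA] <-]//].
      have [A XA AB] := S'X B SB; exists A => //; split=> //=.
      by rewrite /preimage/= AB.
    by have [_ _] := cap (X `&` phi @^-1` S') (@subIsetl _ _ _); apply.
- move=> rho rhoA S SX.
  have hrho A : X A -> has_density R (rho A).
    by move=> XA; exact: (@funS _ _ _ _ rho).
  have drho A : X A -> density R (rho A) = density R A.
    by move=> XA; apply: symdens (rhoA A XA); [exact: hrho|exact: Xdens].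
  have ae A : X A -> ae_subset (R := R) (phi A) (rho A) /\
      ae_subset (R := R) (rho A) (phi A).
    move=> XA; have /symdiff_nullP[Ar rA] := rhoA A XA.
    have /symdiff_nullP[Ap pA] := CX A XA.
    by split; [exact: ae_subset_trans Ap rA|exact: ae_subset_trans Ar pA].
  have [hP dP _] := cup S SX; have [hD dD _] := cap S SX.
  have phid A : S A -> has_density R (phi A) by move=> /SX/Cdens[].
  have rhod A : S A -> has_density R (rho A) by move=> /SX/hrho.
  split=> -[hQ dQ]; apply/symdiff_nullP; split.
  + apply: ae_subset_bigcup => // [A /SX/ae[]//|].
    by have [] := has_densityP hP; rewrite dP.
  + apply: ae_subset_bigcup => // [A /SX/ae[]//|].
    by have [] := has_densityP hQ; rewrite dQ.
  + apply: ae_subset_bigcap => // [A /SX/ae[]//|].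
    by have [] := has_densityP hQ; rewrite dQ.
  + apply: ae_subset_bigcap => // [A /SX/ae[]//|].
    by have [] := has_densityP hD; rewrite dD.
Unshelve. all: by end_near. Qed.
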